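(* Let $I \subseteq [0,1)$ be a set with non-empty interior, let $a, c > 0$ with $a \neq 1$, and let $\gamma \in \mathbb{R} \setminus \{0\}$. Then for Lebesgue-almost every $\alpha > 1$, the system \[ \|a^{1/\alpha} n\| \leq \frac{c}{n^{\alpha - 1}}, \qquad \{\gamma n^\alpha\} \in I \] has infinitely many solutions $n \in \mathbb{N}$ if $\alpha < 2$, and only finitely many solutions $n \in \mathbb{N}$ if $\alpha > 2$.
   Context: $\mathbb{N}$ is the set of positive integers; $\|x\|$ denotes the distance from $x \in \mathbb{R}$ to the nearest integer and $\{x\}$ denotes the fractional part of $x$. *)

(* Defs.v *)
From HB Require Import structures.
From mathcomp Require Import all_boot all_order all_algebra.
From mathcomp Require Import all_classical all_reals all_analysis.

Set Implicit Arguments.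
Unset Strict Implicit.
Unset Printing Implicit Defensive.

Import Order.TTheory GRing.Theory Num.Theory.
Import numFieldNormedType.Exports.

Local Open Scope classical_set_scope.
Local Open Scope ring_scope.

Definition dist_int (R : realType) (x : R) : R :=
  inf [set `|x - m%:~R| | m in [set: int]].

Definition frac_part (R : realType) (x : R) : R := x - (Num.floor x)%:~R.

(* Exponents are real, so powers are [powR], which is the usual power here:
   the bases a and n are positive. *)
Definition solutions (R : realType) (I : set R) (a c gamma alpha : R) : set nat :=
  [set n : nat | [/\ (0 < n)%N,
     dist_int (a `^ (1 / alpha) * n%:R) <= c / n%:R `^ (alpha - 1) &
     I (frac_part (gamma * n%:R `^ alpha))]].

(* Main.v *)
(* For alpha > 2 this is Borel-Cantelli: alpha |-> a^(1/alpha) is bi-Lipschitz, so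
   the exponents in a bounded range for which n solves the inequality are covered
   by O(n) intervals of length O(n^(-alpha)).
   For alpha < 2, Dirichlet's theorem provides, for every alpha, arbitrarily large n
   with ||a^(1/alpha) n|| <= (c/4) / n^(alpha-1).  Perturbing alpha by
   r = 2 / (|gamma| n^alpha ln n) keeps the inequality (with c instead of c/4), while
   gamma n^alpha sweeps more than a full period, so that the fractional part lies in
   an interval contained in I for a fixed proportion of the exponents near alpha.
   Hence the exponents without solutions beyond a given N form a porous set, which
   is null by the Lebesgue density theorem. *)
Require Import Defs.
From HB Require Import structures.
From mathcomp Require Import all_boot all_order all_algebra.
From mathcomp Require Import all_classical all_reals all_analysis.
From mathcomp Require Import ring lra zify.

Set Implicit Arguments.
Unset Strict Implicit.
Unset Printing Implicit Defensive.

Import Order.TTheory GRing.Theory Num.Theory.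
Import numFieldNormedType.Exports.

Local Open Scope classical_set_scope.
Local Open Scope ring_scope.

(** * Distance to the integers and fractional parts *)

Lemma dist_int_le (R : realType) (x : R) (m : int) : dist_int x <= `|x - m%:~R|.
Proof.
by apply: ge_inf; [exists 0 => _ [k _ <-]|exists m].
Qed.

(** A strict bound on an infimum passes to some member, so attainment need not be shown. *)
Lemma dist_int_lt (R : realType) (x y : R) :
  dist_int x < y -> exists m : int, `|x - m%:~R| < y.
Proof.
move=> /inf_lt[|_ [m _ <-] xmy]; last by exists m.
by exists `|x - 0%:~R|, 0.
Qed.

(** As [I] lies in [[0, 1[], an integer translate of [y] that falls in [I] must be its fractional
    part. *)
Lemma frac_part_mem (R : realType) (I : set R) (I_sub : I `<=` `[0, 1[)
  (k : int) (y : R) : I (y - k%:~R) -> I (frac_part y).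
Proof.
move=> Iy; suff -> : frac_part y = y - k%:~R by [].
have := I_sub _ Iy; rewrite /= in_itv/= /frac_part => /andP[y0 y1].
congr (_ - _%:~R); apply/floor_def; rewrite intrD1; apply/andP; split; lra.
Qed.

(** * Bi-Lipschitz bounds for [alpha |-> a^(1/alpha)] *)

(** Here and in the lower bound, [1 + x <= expR x] replaces the mean value theorem, after the
    exponential at one endpoint is factored out. *)
Lemma expR_dist_le (R : realType) (b s t : R) : `|s| <= b -> `|t| <= b ->
  `|expR s - expR t| <= expR b * `|s - t|.
Proof.
wlog st : s t / s <= t => [H sb tb|].
  have [/H|/ltW/H] := leP s t; first exact.
  by rewrite distrC (distrC s); exact.
move=> _ /(le_trans (ler_norm t)) tb.
rewrite (distrC (expR s)) (distrC s) !ger0_norm ?subr_ge0 ?ler_expR//.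
apply: (@le_trans _ _ (expR t * (t - s))); last first.
  by rewrite ler_wpM2r ?subr_ge0// ler_expR.
have -> : expR s = expR t * expR (s - t) by rewrite -expRD addrC subrK.
by have := expR_ge1Dx (s - t); have := expR_gt0 t; nra.
Qed.

Lemma expR_dist_ge (R : realType) (b s t : R) : `|s| <= b -> `|t| <= b ->
  expR (- b) * `|s - t| <= `|expR s - expR t|.
Proof.
wlog st : s t / s <= t => [H sb tb|].
  have [/H|/ltW/H] := leP s t; first exact.
  by rewrite distrC (distrC (expR s)); exact.
rewrite ler_norml => /andP[sb _] _.
rewrite (distrC (expR s)) (distrC s) !ger0_norm ?subr_ge0 ?ler_expR//.
apply: (@le_trans _ _ (expR s * (t - s))).
  by rewrite ler_wpM2r ?subr_ge0// ler_expR.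
have -> : expR t = expR s * expR (t - s) by rewrite -expRD addrC subrK.
by have := expR_ge1Dx (t - s); have := expR_gt0 s; nra.
Qed.

Lemma powR_expR (R : realType) (a x : R) : 0 < a -> a `^ x = expR (x * ln a).
Proof. by move=> a0; rewrite /powR gt_eqF. Qed.

Lemma norm_invM_ln_le (R : realType) (l x : R) : 1 <= x -> `|1 / x * l| <= `|l|.
Proof.
move=> x1; rewrite normrM ler_piMl// div1r ger0_norm ?invr_ge0; last lra.
by rewrite invf_le1//; lra.
Qed.

Lemma powR_inv_dist_le (R : realType) (a x y : R) : 0 < a -> 1 <= x -> 1 <= y ->
  `|a `^ (1 / x) - a `^ (1 / y)| <= expR `|ln a| * `|ln a| * `|x - y|.
Proof.
move=> a0 x1 y1; rewrite !powR_expR//.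
apply: (le_trans (expR_dist_le (norm_invM_ln_le _ x1) (norm_invM_ln_le _ y1))).
rewrite -[leRHS]mulrA ler_wpM2l ?expR_ge0// -mulrBl normrM mulrC ler_wpM2l//.
have -> : 1 / x - 1 / y = (y - x) / (x * y) by field; rewrite !gt_eqF//; lra.
have xy1 : 1 <= x * y by nra.
rewrite normrM distrC ler_piMr// ger0_norm ?invr_ge0; last lra.
by rewrite invf_le1//; lra.
Qed.

(** The map is expanding when [a] differs from 1; the cap [K] on the exponents makes the constant
    uniform, through [x * y <= K ^+ 2]. *)
Lemma powR_inv_dist_ge (R : realType) (a K x y : R) : 0 < a ->
  1 <= x <= K -> 1 <= y <= K ->
  expR (- `|ln a|) * `|ln a| / K ^+ 2 * `|x - y| <= `|a `^ (1 / x) - a `^ (1 / y)|.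
Proof.
move=> a0 /andP[x1 xK] /andP[y1 yK]; rewrite !powR_expR//.
apply: le_trans (expR_dist_ge (norm_invM_ln_le _ x1) (norm_invM_ln_le _ y1)).
rewrite -[leLHS]mulrA -[leLHS]mulrA ler_wpM2l ?expR_ge0// -mulrBl normrM [leRHS]mulrC.
rewrite ler_wpM2l//.
have -> : 1 / x - 1 / y = (y - x) / (x * y) by field; rewrite !gt_eqF//; lra.
have xy1 : 1 <= x * y by nra.
rewrite normrM mulrC distrC ler_wpM2l// ger0_norm ?invr_ge0; last lra.
by rewrite lef_pV2 ?posrE; nra.
Qed.

(** * Porous sets are null *)

(* A need not be measurable: its closure is, almost every point is a density point of
   the closure or lies outside it, and an open gap of A is also a gap of the closure. *)
Lemma porous_negligible (R : realType) (A : set R) (k : R) : 0 < k ->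
  (forall x, A x -> forall e, 0 < e -> exists r p q,
    [/\ 0 < r < e, k * r <= q - p, x - r <= p, q <= x + r &
        forall y, p < y < q -> ~ A y]) ->
  (@lebesgue_measure R).-negligible A.
Proof.
move=> k0 porA.
have mC : measurable (closure A).
  apply: measurable_realfun.closed_measurable; exact: closed_closure.
apply: negligibleS (lebesgue_density mC) => x Ax /= dens.
have Cx : (\1_(closure A) x : R) = 1.
  by rewrite indicE mem_set//; exact: subset_closure.
rewrite Cx in dens.
(* A gap of length at least [k * r] in a ball of length [2 r] leaves a proportion of at most
   [1 - k / 2], which contradicts density 1. *)
have : \forall r \near 0^'+, ((1 - k / 2)%:E <
    lebesgue_measure (closure A `&` ball x r) / lebesgue_measure (ball x r))%E.
  have : \forall y \near (1%:E : \bar R), ((1 - k / 2)%:E < y)%E.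
    by apply: open_ereal_gt'; rewrite lte_fin; lra.
  exact: dens.
move=> -[/= e e0 H].
have [r [p [q [/andP[r0 re] kr xp qx nA]]]] := porA _ Ax _ e0.
have : ball (0:R) e r by rewrite /ball/= sub0r normrN gtr0_norm.
move=> /H /(_ r0).
have pq : p < q by nra.
rewrite lebesgue_measure_ball ?ltW//.
have r2 : r *+ 2 != 0 by rewrite mulrn_eq0/= gt_eqF.
have mb : measurable (closure A `&` ball x r).
  by apply: measurableI => //; exact: measurable_realfun.measurable_ball.
have disj : (closure A `&` ball x r) `&` `]p, q[ = set0.
  apply/seteqP; split => // y [[cAy _] pqy].
  have [z [Az zpq]] := cAy _ (open_nbhs_nbhs (conj (itv_open p q) pqy)).
  by apply: (nA z) => //; move: zpq; rewrite /= in_itv.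
have sub : (closure A `&` ball x r) `|` `]p, q[ `<=` ball x r.
  move=> y [[]//|/=]; rewrite in_itv/= => /andP[py yq].
  by rewrite /ball/= ltr_distlC; apply/andP; split; lra.
have : (lebesgue_measure (closure A `&` ball x r) + (q - p)%:E <= (r *+ 2)%:E)%E.
  have -> : (q - p)%:E = lebesgue_measure (`]p, q[ : set R).
    by rewrite lebesgue_measure_itv/= lte_fin pq EFinB.
  rewrite -measureU// -(lebesgue_measure_ball x (ltW r0)).
  apply: le_measure => //; rewrite inE; first exact: measurableU.
  exact: measurable_realfun.measurable_ball.
have : (0 <= lebesgue_measure (closure A `&` ball x r))%E by exact: measure_ge0.
case: (lebesgue_measure (closure A `&` ball x r)) => [s||]//= s0.
rewrite -EFinD lee_fin => sr; rewrite inver (negbTE r2) -EFinM lte_fin.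
rewrite ltr_pdivlMr; last by rewrite mulrn_wgt0.
by rewrite mulr2n in sr *; nra.
Qed.

(** * Dirichlet approximation with large denominators *)

(** Pigeonhole: two of the [Q + 1] fractional parts of [x * i], [i <= Q], share one of the [Q] boxes
    of length [1 / Q]; subtract them. *)
Lemma dirichlet_approx (R : realType) (x : R) (Q : nat) : (0 < Q)%N ->
  exists (q : nat) (m : int), (0 < q <= Q)%N /\ `|x * q%:R - m%:~R| <= Q%:R^-1.
Proof.
move=> Q0.
have Q0R : 0 < Q%:R :> R by rewrite ltr0n.
pose fr (i : nat) : R := x * i%:R - (Num.floor (x * i%:R))%:~R.
have fr01 i : 0 <= fr i < 1.
  rewrite /fr; have /andP[] := floor_itv (x * i%:R).
  by rewrite intrD1 => h1 h2; apply/andP; split; lra.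
have ltQ i : (Num.truncn (Q%:R * fr i) < Q)%N.
  have /andP[f0 f1] := fr01 i.
  by rewrite -(ltr_nat R); apply: le_lt_trans (_ : _ <= Q%:R * fr i) _;
    [rewrite truncn_le; nra|nra].
pose f (i : 'I_Q.+1) : 'I_Q := Ordinal (ltQ i).
have /injectivePn[i [j ij fij]] : ~~ injectiveb f.
  apply/negP => /injectiveP /leq_card; by rewrite !card_ord ltnn.
wlog {ij} ij : i j fij / (i < j)%N => [H|].
  move: ij; rewrite neq_ltn => /orP[/(H _ _ fij)//|/(H _ _ (esym fij))//].
exists (j - i)%N, (Num.floor (x * j%:R) - Num.floor (x * i%:R)); split.
  by rewrite subn_gt0 ij/= (leq_trans (leq_subr _ _))// -ltnS.
have -> : x * (j - i)%:R - (Num.floor (x * j%:R) - Num.floor (x * i%:R))%:~R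
   = fr j - fr i by rewrite /fr natrB ?(ltnW ij)// rmorphB/=; ring.
have trP k : (Num.truncn (Q%:R * fr k))%:R <= Q%:R * fr k <
    (Num.truncn (Q%:R * fr k))%:R + 1.
  by rewrite natr1; apply: truncn_itv; have := fr01 k; nra.
have /(congr1 (@nat_of_ord _))/= eij := fij.
have := trP i; have := trP j; rewrite eij.
move: (_%:R) => t /andP[h1 h2] /andP[h3 h4].
rewrite -(ler_pM2l Q0R) mulfV ?gt_eqF//.
by rewrite -[X in X * _]gtr0_norm// -normrM ler_norml; apply/andP; split; nra.
Qed.

(* n = (N+1) q with q a Dirichlet denominator; taking a multiple makes n large even when
   x is rational and the denominators q stay bounded. *)
Lemma large_approx (R : realType) (x c alpha : R) (N : nat) : 0 < c ->
  1 < alpha < 2 ->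
  exists (n : nat) (m : int), [/\ (N <= n)%N, (0 < n)%N &
    `|x * n%:R - m%:~R| <= c / n%:R `^ (alpha - 1)].
Proof.
move=> c0 /andP[a1 a2]; pose M : R := N.+1%:R.
have M0 : 0 < M by rewrite ltr0n.
(* Since [alpha < 2], [Q >= T] gives [Q^(2 - alpha) >= M^alpha / c], which rearranges to
   [M / Q <= c / (M Q)^(alpha - 1)]. *)
pose T : R := (M `^ alpha / c) `^ (2 - alpha)^-1.
pose Q := (Num.truncn T).+1.
have TQ : T <= Q%:R by rewrite ltW// truncnS_gt.
have Q0 : 0 < Q%:R :> R by rewrite ltr0n.
have TQ' : M `^ alpha / c <= Q%:R `^ (2 - alpha).
  have -> : M `^ alpha / c = T `^ (2 - alpha).
    rewrite -powRrM mulVf ?powRr1//; last lra.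
    by rewrite divr_ge0// ?powR_ge0 ?ltW.
  by apply: ge0_ler_powR => //; rewrite ?nnegrE ?powR_ge0// ltW//; lra.
have [q [m [/andP[q0 qQ] qm]]] := @dirichlet_approx R x Q isT.
exists (N.+1 * q)%N, (N.+1%:Z * m); split.
- by rewrite (leq_trans (leqnSn N))// leq_pmulr.
- by rewrite muln_gt0.
have -> : x * (N.+1 * q)%:R - (N.+1%:Z * m)%:~R = M * (x * q%:R - m%:~R).
  by rewrite natrM rmorphM/= /M; ring.
rewrite normrM gtr0_norm//.
apply: (@le_trans _ _ (M / Q%:R)); first by rewrite ler_wpM2l// ltW.
apply: (@le_trans _ _ (c / (M * Q%:R) `^ (alpha - 1))); last first.
  apply: ler_wpM2l; first exact: ltW.
  rewrite lef_pV2 ?posrE ?powR_gt0 ?mulr_gt0 ?ltr0n ?muln_gt0//.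
    apply: ge0_ler_powR.
    - lra.
    - by rewrite nnegrE.
    - by rewrite nnegrE mulr_ge0 ?ltW.
    - by rewrite natrM ler_pM2l// ler_nat.
rewrite ler_pdivrMr// mulrAC ler_pdivlMr ?powR_gt0 ?mulr_gt0//.
rewrite (powRM _ (ltW M0) (ltW Q0)) mulrA mulr_powRB1; [|exact: ltW|lra].
rewrite ler_pdivrMr// in TQ'.
have -> : c * Q%:R = Q%:R `^ (2 - alpha) * c * Q%:R `^ (alpha - 1).
  rewrite mulrAC -powRD; last by apply/implyP => _; rewrite gt_eqF.
  by rewrite (_ : _ + _ = 1) ?powRr1 ?ltW//; [rewrite mulrC|ring].
by rewrite ler_wpM2r ?powR_ge0.
Qed.

(** * Windows of good exponents *)

(** An integer translate of []u, u + w[], reflected first if [gamma < 0], starts within distance 1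
    above [Y]. *)
Lemma phase_interval (R : realType) (I : set R) (u w gamma Y : R) :
  I `<=` `[0, 1[ -> gamma != 0 -> (forall y, u < y < u + w -> I y) ->
  exists2 p, Y <= p <= Y + 1 &
    forall s, p < s < p + w -> I (frac_part (Num.sg gamma * s)).
Proof.
move=> I_sub g0 uI; case: (ltgtP gamma 0) => [gn|gp|/eqP]; last by rewrite (negbTE g0).
- have /andP[] := ceil_itv (Y + u + w); move: (Num.ceil _) => k; rewrite intrB => k1 k2.
  exists (k%:~R - u - w); first by apply/andP; split; lra.
  move=> s /andP[s1 s2]; rewrite ltr0_sg// mulN1r.
  apply: (@frac_part_mem _ _ I_sub (- k)); apply: uI.
  by rewrite rmorphN/=; apply/andP; split; lra.
- have /andP[] := ceil_itv (Y - u); move: (Num.ceil _) => k; rewrite intrB => k1 k2.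
  exists (u + k%:~R); first by apply/andP; split; lra.
  move=> s /andP[s1 s2]; rewrite gtr0_sg// mul1r.
  by apply: (@frac_part_mem _ _ I_sub k); apply: uI; apply/andP; split; lra.
Qed.

(** Pull back a phase interval []p, p + w[] by [b |-> |gamma| x^b]. With [Y = |gamma| x^alpha], its
    endpoints lie between [Y] and [Y + 2 <= 2 Y], whence the bounds [r] and [w / 4 * r]. *)
Lemma exponent_window (R : realType) (I : set R) (u w gamma alpha x : R) :
  I `<=` `[0, 1[ -> gamma != 0 -> 0 < w <= 1 ->
  (forall y, u < y < u + w -> I y) -> 1 < x -> 4 <= `|gamma| * x `^ alpha ->
  exists p q, let r := 2 / (`|gamma| * x `^ alpha * ln x) in
    [/\ alpha <= p, q <= alpha + r, w / 4 * r <= q - p &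
        forall b, p < b < q -> I (frac_part (gamma * x `^ b))].
Proof.
move=> I_sub g0 /andP[w0 w1] uI x1 Y4.
have x0 : 0 < x by lra.
have G0 : 0 < `|gamma| by rewrite normr_gt0.
have L0 : 0 < ln x by rewrite ln_gt0.
have [p /andP[Yp pY] pI] := @phase_interval R I u w gamma (`|gamma| * x `^ alpha) I_sub g0 uI.
set Y := `|gamma| * x `^ alpha in Y4 Yp pY *.
have Yln : ln (Y / `|gamma|) = alpha * ln x.
  by rewrite /Y mulrAC mulfV ?gt_eqF// mul1r ln_powR.
have p0 : 0 < p by lra.
(* Tangent line bound for the concave [ln]: taken at [Y] it bounds [q] above, at [p + w] it bounds
   [q - p] below. *)
have lnle (s t : R) : 0 < s -> 0 < t -> ln s <= ln t + (s - t) / t.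
  move=> s0 t0; have -> : s = t * (1 + (s - t) / t) by field; rewrite gt_eqF.
  have st0 : 0 < 1 + (s - t) / t.
    by rewrite (_ : _ + _ = s / t) ?divr_gt0//; field; rewrite gt_eqF.
  rewrite lnM ?posrE// lerD2l; apply: le_trans (le_ln1Dx _) _; first lra.
  by rewrite (_ : t * _ - t = s - t)//; field; rewrite gt_eqF.
exists (ln (p / `|gamma|) / ln x), (ln ((p + w) / `|gamma|) / ln x); split.
- rewrite ler_pdivlMr// -Yln ler_ln ?posrE ?divr_gt0//; last lra.
  by rewrite ler_pM2r// invr_gt0.
- rewrite ler_pdivrMr// [leRHS]mulrDl -Yln !ln_div ?posrE//; try lra.
  have := lnle (p + w) Y; rewrite (_ : 2 / (Y * ln x) * ln x = 2 / Y); last first.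
    by field; rewrite !gt_eqF//; lra.
  have : (p + w - Y) / Y <= 2 / Y by rewrite ler_pM2r ?invr_gt0; lra.
  by move=> h1 h2; have := h2 ltac:(lra) ltac:(lra); lra.
- rewrite -mulrBl -[leLHS]mulr1 -[X in _ * X](mulfV (lt0r_neq0 L0)) mulrA.
  rewrite ler_pM2r ?invr_gt0// !ln_div ?posrE//; try lra.
  have := lnle p (p + w) p0 ltac:(lra).
  rewrite (_ : w / 4 * _ * _ = w / (2 * Y)); last by field; rewrite !gt_eqF//; lra.
  have : w / (2 * Y) <= w / (p + w).
    by rewrite ler_pM2l// lef_pV2 ?posrE; lra.
  rewrite (_ : (p - (p + w)) / (p + w) = - (w / (p + w))); [lra|].
  by rewrite -mulNr; congr (_ / _); lra.
- move=> b /andP[pb bq]; rewrite [gamma in gamma * _]numEsg -mulrA; apply: pI.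
  rewrite ltr_pdivrMr// in pb; rewrite ltr_pdivlMr// in bq.
  have pg : 0 < p / `|gamma| by rewrite divr_gt0.
  have qg : 0 < (p + w) / `|gamma| by rewrite divr_gt0// addr_gt0.
  rewrite -ln_powR ltr_ln ?posrE ?powR_gt0// ltr_pdivrMr// in pb.
  rewrite -ln_powR ltr_ln ?posrE ?powR_gt0// ltr_pdivlMr// in bq.
  by rewrite mulrC pb bq.
Qed.

(** Moving from [alpha] to [b] at most doubles [n^(b - 1)], as [(b - alpha) ln n <= 1/2]. It adds an
    error of at most [(c/4) / n^(alpha - 1)], by the lower bound on [ln n]. The two errors together
    fit into [c / (2 n^(alpha - 1))]. *)
Lemma dist_window (R : realType) (a c G alpha b : R) (n : nat) (m : int) :
  0 < a -> 0 < c -> 0 < G -> (1 < n)%N -> 4 <= G * n%:R `^ alpha ->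
  8 * (expR `|ln a| * `|ln a|) / (G * c) <= ln n%:R ->
  `|a `^ (1 / alpha) * n%:R - m%:~R| <= c / 4 / n%:R `^ (alpha - 1) ->
  1 <= alpha -> alpha <= b <= alpha + 2 / (G * n%:R `^ alpha * ln n%:R) ->
  dist_int (a `^ (1 / b) * n%:R) <= c / n%:R `^ (b - 1).
Proof.
move=> a0 c0 G0 n1 Y4 L8 am al1 /andP[ab br].
set M := expR `|ln a| * `|ln a| in L8.
set N : R := n%:R in Y4 L8 am br *.
have N1 : 1 < N by rewrite ltr1n.
have N0 : 0 < N by lra.
have L0 : 0 < ln N by rewrite ln_gt0.
set P := N `^ (alpha - 1) in am *.
have P0 : 0 < P by rewrite powR_gt0.
have NP : N `^ alpha = N * P by rewrite mulr_powRB1//; lra.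
rewrite NP in Y4 br.
have Y0 : 0 < G * (N * P) by lra.
have E2 : N `^ (b - 1) <= 2 * P.
  have -> : N `^ (b - 1) = P / expR (- ((b - alpha) * ln N)).
    rewrite expRN invrK -powR_expR// /P -powRD ?(gt_eqF N0) ?implybT//.
    by congr (_ `^ _); ring.
  rewrite ler_pdivrMr ?expR_gt0//.
  have h : (b - alpha) * ln N <= 1 / 2.
    apply: (@le_trans _ _ (2 / (G * (N * P)))).
      have -> : 2 / (G * (N * P)) = 2 / (G * (N * P) * ln N) * ln N.
        by field; rewrite !gt_eqF.
      by rewrite ler_pM2r//; lra.
    by rewrite ler_pdivrMr//; lra.
  by have := expR_ge1Dx (- ((b - alpha) * ln N)); nra.
apply: (@le_trans _ _ (c / (2 * P))); last first.
  by rewrite ler_pM2l// lef_pV2 ?posrE ?powR_gt0// mulr_gt0.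
apply: le_trans (dist_int_le _ m) _.
have -> : a `^ (1 / b) * N - m%:~R =
    (a `^ (1 / alpha) * N - m%:~R) + (a `^ (1 / b) - a `^ (1 / alpha)) * N by ring.
apply: le_trans (ler_normD _ _) _.
have -> : c / (2 * P) = c / 4 / P + c / 4 / P by field; rewrite gt_eqF.
apply: lerD => //; rewrite normrM (gtr0_norm N0).
have : `|a `^ (1 / b) - a `^ (1 / alpha)| <= M * (b - alpha).
  have := @powR_inv_dist_le R a b alpha a0 ltac:(lra) al1.
  by rewrite (ger0_norm (_ : 0 <= b - alpha)) ?subr_ge0.
have M0 : 0 <= M by rewrite mulr_ge0// expR_ge0.
have : M * (b - alpha) <= M * (2 / (G * (N * P) * ln N)) by rewrite ler_wpM2l//; lra.
move=> h1 h2; apply: (@le_trans _ _ (M * (2 / (G * (N * P) * ln N)) * N)).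
  by rewrite ler_pM2r//; lra.
have -> : M * (2 / (G * (N * P) * ln N)) * N = (2 * M / (G * ln N)) / P.
  by field; rewrite !gt_eqF.
rewrite ler_pM2r ?invr_gt0//.
rewrite ler_pdivrMr ?mulr_gt0//.
rewrite ler_pdivrMr ?mulr_gt0// in L8.
by have := L8; lra.
Qed.

Lemma ball_subset_window (R : realType) (I : set R) : I° !=set0 ->
  exists u w, 0 < w <= 1 /\ forall y : R, u < y < u + w -> I y.
Proof.
move=> [x [/= e e0 eI]]; pose d := Num.min e (1 / 2).
have d0 : 0 < d by rewrite lt_min e0/=; lra.
have de : d <= e by rewrite ge_min lexx.
have d2 : d <= 1 / 2 by rewrite ge_min lexx orbT.
exists (x - d), (2 * d); split; first by apply/andP; split; lra.
move=> y /andP[y1 y2]; apply: eI; rewrite /ball/= ltr_distl.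
by apply/andP; split; lra.
Qed.

(** * Exponents below 2 *)

(** One and the same [n] solves the system for every exponent in the window []p, q[]; this is the
    gap that porosity asks for, with ratio [w / 4]. *)
Lemma unsolvable_negligible (R : realType) (I : set R) (a c gamma : R) (N : nat) :
  I `<=` `[0, 1[ -> I° !=set0 -> 0 < a -> 0 < c -> gamma != 0 ->
  (@lebesgue_measure R).-negligible [set alpha | 1 < alpha < 2 /\
    forall n, (N <= n)%N -> ~ solutions I a c gamma alpha n].
Proof.
move=> I_sub /ball_subset_window[u [w [w01 uI]]] a0 c0 g0.
have [w0 w1] := andP w01.
have G0 : 0 < `|gamma| by rewrite normr_gt0.
apply: (@porous_negligible _ _ (w / 4)); first lra.
move=> x [/andP[x1 x2] _] e e0.
(* With [ln n > T], the first summand meets the hypothesis of [dist_window] and [e^-1] forces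
   [r < e]. *)
pose T := 8 * (expR `|ln a| * `|ln a|) / (`|gamma| * c) + e^-1.
have T8 : 0 <= 8 * (expR `|ln a| * `|ln a|) / (`|gamma| * c).
  by rewrite divr_ge0 ?mulr_ge0 ?expR_ge0// ltW.
have ei0 : 0 < e^-1 by rewrite invr_gt0.
(* [N1] yields [ln n > T], [N2] yields [|gamma| n^x >= 4], and the extra 2 yields [n > 1]. *)
pose N1 := (Num.truncn (expR T)).+1; pose N2 := (Num.truncn (4 / `|gamma|)).+1.
have [n [m [nN n0 nm]]] :=
  @large_approx R (a `^ (1 / x)) (c / 4) x (N + N1 + N2 + 2)%N
    ltac:(lra) ltac:(apply/andP; split; lra).
have n1 : (1 < n)%N by rewrite (leq_trans _ nN)// !addnS ltnS.
have n1R : 1 < n%:R :> R by rewrite ltr1n.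
have nT : expR T < n%:R.
  apply: lt_le_trans (truncnS_gt _) _.
  by rewrite ler_nat (leq_trans _ nN)// -!addnA addnCA leq_addr.
have ng : 4 / `|gamma| < n%:R.
  apply: lt_le_trans (truncnS_gt _) _.
  by rewrite ler_nat (leq_trans _ nN)// -addnA addnCA leq_addr.
have Tln : T < ln n%:R by rewrite -(expRK T) ltr_ln ?posrE ?expR_gt0 ?ltr0n.
have Y4 : 4 <= `|gamma| * n%:R `^ x.
  rewrite ltr_pdivrMr// in ng.
  have : n%:R <= n%:R `^ x :> R by apply: le1r_powR; exact: ltW.
  by nra.
have [p [q []]] := exponent_window I_sub g0 w01 uI n1R Y4.
set r := 2 / _; move=> xp qr wr pqI.
have L0 : 0 < ln n%:R :> R by rewrite ln_gt0.
have r0 : 0 < r by rewrite divr_gt0// mulr_gt0//; lra.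
have re : r < e.
  rewrite /r ltr_pdivrMr; last by rewrite mulr_gt0//; lra.
  have : 1 < e * ln n%:R.
    rewrite mulrC -ltr_pdivrMr// div1r; apply: le_lt_trans Tln.
    by rewrite /T lerDr.
  by move: Y4; move: (_ * _ `^ _) => Y Y4 h; nra.
exists r, p, q; split => //; first by apply/andP; split.
- by lra.
move=> y pqy [_ /(_ n)]; apply.
  by rewrite (leq_trans _ nN)// -!addnA leq_addr.
have [py yq] := andP pqy.
split; [exact: ltnW | | exact: pqI].
apply: (@dist_window R a c `|gamma| x y n m) => //.
- by apply: le_trans (ltW Tln); rewrite /T lerDl ltW.
- exact: ltW.
- by rewrite -/r; apply/andP; split; lra.
Qed.

(** * Exponents above 2: Borel-Cantelli *)

Lemma pseries_le (R : realType) (e : R) (N : nat) : 0 < e ->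
  \sum_(k < N) (k.+2%:R `^ (1 + e))^-1 <= e^-1.
Proof.
move=> e0; pose f k : R := (k.+1%:R `^ e)^-1.
(* From ln (k+2) - ln (k+1) >= 1 / (k+2): the sum is dominated by a telescoping one. *)
have step k : (k.+2%:R `^ (1 + e))^-1 <= e^-1 * (f k - f k.+1).
  rewrite -(ler_pM2l e0) mulrA mulfV ?gt_eqF// mul1r /f.
  have x0 : 0 < k.+1%:R :> R by rewrite ltr0n.
  have y0 : 0 < k.+2%:R :> R by rewrite ltr0n.
  have yx : k.+2%:R = k.+1%:R + 1 :> R by rewrite natr1.
  move: x0 y0 yx; move: (k.+1%:R : R) (k.+2%:R : R) => x y x0 y0 yx.
  have lnxy : ln x <= ln y - y^-1.
    have -> : x = y * (1 + - y^-1) by rewrite yx; field; rewrite -yx gt_eqF.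
    have y1 : y^-1 < 1 by rewrite invf_lt1//; lra.
    by rewrite lnM ?posrE ?subr_gt0// lerD2l; apply: le_ln1Dx; lra.
  (* The exponential is at least [1 + e / y], so consecutive terms differ by at least
     [e / y^(1 + e)]. *)
  have -> : (x `^ e)^-1 = (y `^ e)^-1 * expR (e * (ln y - ln x)).
    by rewrite !powR_expR// -!expRN -expRD; congr expR; ring.
  rewrite powRD ?(gt_eqF y0) ?implybT// (powRr1 (ltW y0)) invfM.
  have z0 : 0 < (y `^ e)^-1 by rewrite invr_gt0 powR_gt0.
  have := expR_ge1Dx (e * (ln y - ln x)); move: z0 lnxy.
  move: (y `^ e)^-1 (expR _) y^-1 => z E i z0 lnxy h.
  have : e * i <= e * (ln y - ln x) by rewrite ler_pM2l//; lra.
  move=> ei; have : 0 <= z * (E - 1 - e * i) by rewrite mulr_ge0//; lra.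
  by lra.
apply: (@le_trans _ _ (\sum_(k < N) e^-1 * (f k - f k.+1))); first exact: ler_sum.
rewrite -mulr_sumr -[leRHS]mulr1 ler_wpM2l ?invr_ge0 ?(ltW e0)//.
rewrite -(big_mkord xpredT (fun k => f k - f k.+1)).
have -> : \sum_(0 <= k < N) (f k - f k.+1) = f 0%N - f N.
  rewrite -[LHS]opprK -sumrN -opprB; congr (- _).
  rewrite -telescope_sumr//; apply: eq_bigr => k _; exact: opprB.
by rewrite /f powR1 invr1 gerBl invr_ge0 powR_ge0.
Qed.

(** First Borel-Cantelli lemma, applied to measurable covers because the sets [E k] may fail to be
    measurable. *)
Lemma limsup_negligible (R : realType) (E : (set R)^nat) (u : nat -> R) (B : R) :
  (forall N, \sum_(k < N) u k <= B) ->
  (forall k, exists U : set R, [/\ measurable U, E k `<=` U &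
     (@lebesgue_measure R U <= (u k)%:E)%E]) ->
  (@lebesgue_measure R).-negligible (lim_sup_set E).
Proof.
move=> uB /choice[U] /all_and3[mU EU Uu].
exists (lim_sup_set U); split.
- apply: bigcapT_measurable => n; apply: bigcup_measurable => k _; exact: mU.
- apply: lim_sup_set_cvg0; first exact: mU.
  apply: (@le_lt_trans _ _ B%:E); last exact: ltry.
  apply: lime_le; first by apply: is_cvg_nneseries => *; exact: measure_ge0.
  apply: nearW => N; rewrite big_mkord.
  apply: (@le_trans _ _ (\sum_(k < N) (u k)%:E)%E).
    by apply: lee_sum => k _; exact: Uu.
  by rewrite sumEFin lee_fin.
- by move=> x Ex n _; have [k nk Ekx] := Ex n I; exists k => //; exact: EU.
Qed.

Lemma diam_cover (R : realType) (F : set R) (d : R) : 0 <= d ->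
  (forall x y, F x -> F y -> `|x - y| <= d) ->
  exists U : set R, [/\ measurable U, F `<=` U &
    (@lebesgue_measure R U <= (2 * d)%:E)%E].
Proof.
(* If F is empty then z = 0, and the interval is harmless. *)
move=> d0 Fd; pose z := xget 0 F; exists (`[z - d, z + d]%classic : set R); split => //.
  move=> x Fx; have Fz : F z by apply: xgetPex; exists x.
  by rewrite /= in_itv/= -ler_distl; exact: Fd.
rewrite lebesgue_measure_itv/= lte_fin; case: ifP => _; rewrite -?EFinB lee_fin; lra.
Qed.

(** Indexes the candidate integers by naturals; the crude count [3 * M] affects only constants. *)
Lemma int_shift (m : int) (M : nat) : `|m| < M%:Z ->
  exists2 i : nat, m = i%:Z - M%:Z & (i < 3 * M)%N.
Proof. by move=> mM; exists (absz (m + M%:Z)); lia. Qed.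

(** On the range [[2 + e, K]] both the expansion constant [kap] and the series exponent [1 + e] are
    uniform. *)
Lemma solvable_negligible (R : realType) (I : set R) (a c gamma e K : R) :
  0 < a -> a != 1 -> 0 < c -> 0 < e ->
  (@lebesgue_measure R).-negligible [set alpha | 2 + e <= alpha <= K /\
    infinite_set (solutions I a c gamma alpha)].
Proof.
move=> a0 a1 c0 e0.
have la0 : 0 < `|ln a| by rewrite normr_gt0 ln_eq0.
pose B := Num.max 1 K; have B0 : 0 < B by rewrite lt_max ltr01.
pose kap := expR (- `|ln a|) * `|ln a| / B ^+ 2.
have kap0 : 0 < kap by rewrite !mulr_gt0 ?expR_gt0 ?invr_gt0 ?exprn_gt0.
have := @powR_inv_dist_ge R a B; rewrite -/kap => kapge; clearbody kap.
(* Any integer [m] close to [a^(1/alpha) n] satisfies [|m| < C n]. *)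
pose C := (Num.truncn (expR `|ln a| + 2 * c)).+1.
(* Here [n = k + 2]. Doubling [c] gives the strict inequality that extracts an integer from the
   infimum. *)
pose psi k : R := 2 * c / k.+2%:R `^ (1 + e).
have psi0 k : 0 < psi k by rewrite /psi divr_gt0 ?powR_gt0 ?mulr_gt0.
pose F k (i : nat) := [set alpha | 2 + e <= alpha <= K /\
  `|a `^ (1 / alpha) * k.+2%:R - (i%:Z - (C * k.+2)%:Z)%:~R| < psi k].
(* Two exponents served by the same integer have values of [a^(1/alpha) n] less than [2 * psi k]
   apart; divide by the expansion factor [kap * n]. *)
pose d k := 2 * psi k / (kap * k.+2%:R).
have d0 k : 0 < d k.
  by apply: divr_gt0; [exact: mulr_gt0|apply: mulr_gt0].
have diamF k i x y : F k i x -> F k i y -> `|x - y| <= d k.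
  move=> [/andP[x1 x2] Fx] [/andP[y1 y2] Fy].
  have KB : K <= B by rewrite le_max lexx orbT.
  have := kapge x y a0.
  rewrite !(le_trans _ KB)// !andbT => /(_ ltac:(lra) ltac:(lra)) h.
  have n0 : 0 < k.+2%:R :> R by rewrite ltr0n.
  rewrite ler_pdivlMr ?(mulr_gt0 kap0 n0)// mulrCA mulrA.
  apply: (@le_trans _ _ (`|a `^ (1 / x) - a `^ (1 / y)| * k.+2%:R)).
    by rewrite ler_pM2r.
  rewrite -[X in _ * X](gtr0_norm n0) -normrM mulrBl.
  move: Fx Fy; move: (_%:~R) => m; rewrite !ltr_norml ler_norml.
  by move=> /andP[? ?] /andP[? ?]; apply/andP; split; lra.
pose E k := [set alpha | 2 + e <= alpha <= K /\ solutions I a c gamma alpha k.+2].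
have EF k : E k `<=` \big[setU/set0]_(i < 3 * (C * k.+2)) F k i.
  move=> x [/andP[x1 x2] [_ + _]].
  have psiE : c / k.+2%:R `^ (x - 1) < psi k.
    rewrite /psi ltr_pdivrMr ?powR_gt0// mulrAC ltr_pdivlMr ?powR_gt0//.
    have h : (k.+2%:R : R) `^ (1 + e) <= k.+2%:R `^ (x - 1).
      by apply: ler_powR; [rewrite ler1n|lra].
    have := powR_gt0 (x - 1) (ltr0Sn R k.+1).
    by move: (_ `^ (x - 1)) h => t h t0; nra.
  move=> /le_lt_trans /(_ psiE) /dist_int_lt[m hm].
  have mC : `|m| < (C * k.+2)%:Z.
    rewrite -(ltr_int R) intr_norm.
    have t1 : 1 <= k.+2%:R :> R by rewrite ler1n.
    have CB : expR `|ln a| + 2 * c < C%:R by exact: truncnS_gt.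
    have pc : psi k <= 2 * c.
      rewrite /psi ler_pdivrMr ?powR_gt0// ler_peMr ?mulr_ge0 ?(ltW c0)//.
      by rewrite -[leLHS](powRr0 k.+2%:R); apply: ler_powR; lra.
    have ax : a `^ (1 / x) <= expR `|ln a|.
      rewrite powR_expR// ler_expR.
      by apply: le_trans (ler_norm _) _; apply: norm_invM_ln_le; lra.
    have -> : m%:~R = a `^ (1 / x) * k.+2%:R - (a `^ (1 / x) * k.+2%:R - m%:~R) :> R.
      by rewrite subKr.
    apply: le_lt_trans (ler_normB _ _) _.
    rewrite ger0_norm ?mulr_ge0 ?powR_ge0//.
    rewrite -pmulrn natrM; move: hm pc CB ax t1.
    move: `|a `^ (1 / x) * k.+2%:R - m%:~R| (psi k) (a `^ (1 / x)) (expR _) => p q r s.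
    by move=> *; nra.
  have [i iE ilt] := int_shift mC.
  rewrite -bigcup_mkord; exists i => //.
  by rewrite /F/= -iE; split => //; apply/andP.
(* There are [3 C n] intervals of measure at most [2 d = 8 c / (kap n n^(1 + e))]. *)
pose D : R := 24 * C%:R * c / kap.
have : (@lebesgue_measure R).-negligible (lim_sup_set E).
  apply: (@limsup_negligible _ _ (fun k => D * (k.+2%:R `^ (1 + e))^-1) (D * e^-1)).
    move=> N; rewrite -mulr_sumr ler_wpM2l ?pseries_le//.
    by rewrite divr_ge0 ?mulr_ge0 ?(ltW c0) ?(ltW kap0).
  move=> k.
  have /choice[U /all_and3[mU FU Ud]] i := diam_cover (ltW (d0 k)) (@diamF k i).
  exists (\big[setU/set0]_(i < 3 * (C * k.+2)) U i); split.
  - exact: bigsetU_measurable.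
  - apply: subset_trans (EF k) _; rewrite -!bigcup_mkord.
    by apply: subset_bigcup => i _; exact: FU.
  - apply: le_trans; first by apply: Boole_inequality => i _; exact: mU.
    apply: (@le_trans _ _ (\sum_(i < 3 * (C * k.+2)) (2 * d k)%:E)%E).
      by apply: lee_sum => i _; exact: Ud.
    rewrite sumEFin lee_fin sumr_const card_ord -[_ *+ (3 * _)]mulr_natl !natrM /d /psi /D.
    rewrite le_eqVlt; apply/orP; left; apply/eqP; field.
    by rewrite !gt_eqF ?powR_gt0.
(* If no [E k] with [k >= N] contains [x], all solutions are below [N + 2]; this includes the values
   0 and 1 that the indexing skips. *)
apply: negligibleS => x [xK inf] N _; apply: contrapT => nE; apply: inf.
apply: (@sub_finite_set _ _ `I_(N + 2)); last exact: finite_II.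
move=> [|[|k]] Sk /=; rewrite ?addn2// !ltnS ltnNge; apply/negP => Nk.
by apply: nE; exists k.
Qed.

(** * Countable union of the exceptional sets *)

Theorem theorem2 (R : realType) (I : set R) (a c gamma : R)
    (I_sub : I `<=` `[0, 1[) (I_int : I° !=set0)
    (a_gt0 : 0 < a) (c_gt0 : 0 < c) (a_neq1 : a != 1) (gamma_neq0 : gamma != 0) :
  {ae (@lebesgue_measure R), forall alpha : R, 1 < alpha ->
    (alpha < 2 -> infinite_set (solutions I a c gamma alpha)) /\
    (2 < alpha -> finite_set (solutions I a c gamma alpha))}.
Proof.
have few := negligible_bigcup (fun N =>
  unsolvable_negligible N I_sub I_int a_gt0 c_gt0 gamma_neq0).
(* The ranges [[2 + 1/(K + 1), K]] exhaust the exponents above 2. *)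
have many := negligible_bigcup (fun K : nat => @solvable_negligible R I a c gamma
  K.+1%:R^-1 K%:R a_gt0 a_neq1 c_gt0 ltac:(by rewrite invr_gt0)).
apply: negligibleS (negligibleU few many) => x /= /not_implyP[x1 /not_andP].
move=> [|] /not_implyP[x2 nS]; [left|right].
- have /finite_fsetP[S SE] := contrapT nS.
  (* A finite solution set has no element beyond its maximum. *)
  exists (\max_(i <- finmap.enum_fset S) i).+1 => //; split; first by apply/andP.
  move=> n Sn; rewrite SE /= => nS'.
  by have := @leq_bigmax_seq nat _ xpredT id n nS' isT; rewrite leqNgt Sn.
- exists (maxn (Num.truncn x).+1 (Num.truncn (x - 2)^-1)) => //; split => //.
  set K := maxn _ _; have x20 : 0 < x - 2 by lra.
  have xK : x <= K%:R.
    by apply: le_trans (ltW (truncnS_gt x)) _; rewrite ler_nat leq_maxl.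
  have x2K : (x - 2)^-1 <= K.+1%:R.
    by apply: le_trans (ltW (truncnS_gt _)) _; rewrite ler_nat ltnS leq_maxr.
  rewrite xK andbT -lerBrDl -[x - 2]invrK lef_pV2 ?posrE ?invr_gt0 ?ltr0n//.
Qed.
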